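(* Let $J_1\subseteq\Delta^{r_1}_{n_1}$ and $J_2\subseteq\Delta^{r_2}_{n_2}$ be M-convex sets. Then for every tract $F$ there is a canonical bijection $\mathrm{Gr}_{J_1\oplus J_2}(F)\to\mathrm{Gr}_{J_1}(F)\times\mathrm{Gr}_{J_2}(F)$, natural in $F$.
   Context: M-convex sets: nonempty $J\subseteq\Delta^r_n=\{\alpha\in\mathbb N^n:\sum\alpha_i=r\}$ with the exchange property. Direct sum: for $\alpha_1\in\mathbb N^{n_1}$, $\alpha_2\in\mathbb N^{n_2}$ let $\alpha_1\oplus\alpha_2\in\mathbb N^{n_1+n_2}$ be the concatenation; $J_1\oplus J_2=\{\alpha_1\oplus\alpha_2:\alpha_1\in J_1,\alpha_2\in J_2\}\subseteq\Delta^{r_1+r_2}_{n_1+n_2}$ (M-convex). Tract: commutative monoid with absorbing $0$, nonzero elements a group, null set an ideal of $\mathbb N[F^\times]$ with unique additive inverses; morphisms multiplicative, preserving $0,1$, null sums. For M-convex $J\subseteq\Delta^r_n$, with $\delta^\mp_J$ the componentwise min/max, $\bar J=J-\delta^-_J$, $\bar r=r-|\delta^-_J|$, $\omega_J=\delta^+_J-\delta^-_J$, $\Sigma\boldsymbol\beta=\sum_m\epsilon_{\beta_m}$, a strong $F$-representation is $\rho\colon[n]^{\bar r}\to F$ with $\rho(\boldsymbol\beta)\ne0\iff\Sigma\boldsymbol\beta\in\bar J$, $\rho$ alternating, and $\sum_{k=0}^s(-1)^k\rho(\boldsymbol\alpha i_0\dots\widehat{i_k}\dots i_s)\rho(\boldsymbol\alpha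 i_kj_2\dots j_s)\in N_F$ for $2\le s\le\bar r$, $\boldsymbol\alpha\in[n]^{\bar r-s}$ and indices with $\Sigma(\boldsymbol\alpha i_0\dots i_sj_2\dots j_s)\le\omega_J$. $\mathrm{Gr}_J(F)$ = strong $F$-representations modulo scaling by $F^\times$. *)

(* Defs.v *)
From HB Require Import structures.
From mathcomp Require Import all_boot all_order all_fingroup.
From mathcomp Require Import finmap.
From Stdlib Require Import Permutation.

Set Implicit Arguments.
Unset Strict Implicit.
Unset Printing Implicit Defensive.

Local Open Scope fset_scope.

(* Tracts.  Elements of N[F^x] (finite formal sums of nonzero elements *)
(* with natural coefficients) are represented by lists of elements of *)
(* F, modulo permutation and modulo occurrences of 0 (which denote the *)
(* empty summand).  The null set is a predicate on such lists that is *)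
(* invariant under these identifications.                              *)

Record tract := Tract {
  tcar :> Type;
  tzero : tcar;
  tone : tcar;
  tmul : tcar -> tcar -> tcar;
  teps : tcar;
  tnull : seq tcar -> Prop;
  tmulA : forall x y z, tmul x (tmul y z) = tmul (tmul x y) z;
  tmulC : forall x y, tmul x y = tmul y x;
  tmul1 : forall x, tmul tone x = x;
  tmul0 : forall x, tmul tzero x = tzero;
  tone_neq0 : tone <> tzero;
  tmul_neq0 : forall x y, x <> tzero -> y <> tzero -> tmul x y <> tzero;
  tinv : forall x, x <> tzero -> exists y, tmul x y = tone;
  (* well-definedness of N_F as a subset of N[F^x] *)
  tnull_perm : forall s t, Permutation s t -> tnull s -> tnull t;
  tnull_zero : forall s, tnull (tzero :: s) <-> tnull s;
  tnull_nil : tnull [::];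
  tnull_add : forall s t, tnull s -> tnull t -> tnull (s ++ t);
  tnull_mul : forall a s, tnull s -> tnull (map (tmul a) s);
  tnull_inv : forall a, exists! b, tnull [:: a; b];
  tnull_eps : tnull [:: tone; teps]
}.

Arguments tzero {_}.
Arguments tone {_}.
Arguments teps {_}.
Arguments tmul {_}.
Arguments tnull {_}.

Record tract_morph (F G : tract) := TractMorph {
  tmap :> F -> G;
  tmap0 : tmap tzero = tzero;
  tmap1 : tmap tone = tone;
  tmapM : forall x y, tmap (tmul x y) = tmul (tmap x) (tmap y);
  tmapN : forall s, tnull s -> tnull (map tmap s)
}.

Definition tsign (F : tract) (k : nat) : F := iter k (tmul teps) tone.

Notation vec n := {ffun 'I_n -> nat}.

Definition exch (n : nat) (a : vec n) (i j : 'I_n) : vec n :=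
  [ffun k => a k + (k == j) - (k == i)].

Definition in_simplex (n r : nat) (J : {fset vec n}) : Prop :=
  forall a, a \in J -> \sum_(i < n) a i = r.

Definition Mconvex (n r : nat) (J : {fset vec n}) : Prop :=
  [/\ J != fset0, in_simplex r J &
      forall a b (i : 'I_n), a \in J -> b \in J -> b i < a i ->
        exists j : 'I_n, a j < b j /\ exch a i j \in J].

Definition vcat (n1 n2 : nat) (a : vec n1) (b : vec n2) : vec (n1 + n2) :=
  [ffun k => match split k with inl i => a i | inr j => b j end].

Definition dsum (n1 n2 : nat) (J1 : {fset vec n1}) (J2 : {fset vec n2})
  : {fset vec (n1 + n2)} :=
  [fset vcat a b | a in J1, b in J2].

Definition dmax (n : nat) (J : {fset vec n}) : vec n :=
  [ffun i => \max_(a <- J) a i].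
Definition dmin (n : nat) (J : {fset vec n}) : vec n :=
  [ffun i => \big[minn/dmax J i]_(a <- J) a i].
Definition omega (n : nat) (J : {fset vec n}) : vec n :=
  [ffun i => dmax J i - dmin J i].
Definition rbar (n r : nat) (J : {fset vec n}) : nat :=
  r - \sum_(i < n) dmin J i.

Definition in_Jbar (n : nat) (J : {fset vec n}) (c : vec n) : Prop :=
  exists2 a, a \in J & forall i, a i - dmin J i = c i.

Definition cnt (n : nat) (s : seq 'I_n) : vec n := [ffun i => count_mem i s].

Definition word_fun (F : tract) (n m : nat) := m.-tuple 'I_n -> F.

Definition rep_type (F : tract) (n r : nat) (J : {fset vec n}) :=
  word_fun F n (rbar r J).

(* evaluation of rho on a list (which will always have the right length) *)
Definition tev (F : tract) (n m : nat) (rho : word_fun F n m) (s : seq 'I_n) : F :=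
  match (insub s : option (m.-tuple 'I_n)) with
  | Some t => rho t
  | None => tzero
  end.

Definition alternating (F : tract) (n m : nat) (rho : word_fun F n m) : Prop :=
  forall (s : 'S_m) (t : m.-tuple 'I_n),
    rho [tuple tnth t (s i) | i < m] = tmul (if odd_perm s then teps else tone) (rho t).

Definition rem_at (n s : nat) (i : s.+1.-tuple 'I_n) (k : 'I_s.+1) : seq 'I_n :=
  [seq tnth i l | l <- enum 'I_s.+1 & l != k].

Definition plucker (F : tract) (n m : nat) (om : vec n) (rho : word_fun F n m) : Prop :=
  forall s : nat, 2 <= s <= m ->
  forall (al : seq 'I_n) (i : s.+1.-tuple 'I_n) (j : s.-1.-tuple 'I_n),
    size al = m - s ->
    (forall x, count_mem x (al ++ i ++ j) <= om x) ->
    tnull [seq tmul (tsign F (nat_of_ord k))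
                    (tmul (tev rho (al ++ rem_at i k)) (tev rho (al ++ tnth i k :: j)))
          | k : 'I_s.+1 <- enum 'I_s.+1].

Definition strong_rep (F : tract) (n r : nat) (J : {fset vec n})
  (rho : rep_type F r J) : Prop :=
  [/\ forall t, rho t <> tzero <-> in_Jbar J (cnt t),
      alternating rho &
      plucker (omega J) rho].

(* scaling equivalence: Gr_J(F) = strong representations modulo F^x *)
Definition rep_equiv (F : tract) (n m : nat) (rho rho' : word_fun F n m) : Prop :=
  exists2 c : F, c <> tzero & forall t, rho' t = tmul c (rho t).

Definition rep_map (F G : tract) (f : tract_morph F G) (n m : nat)
  (rho : word_fun F n m) : word_fun G n m := fun t => f (rho t).

(* Main.v *)
Require Import Defs.
From HB Require Import structures.
From mathcomp Require Import all_boot all_order all_fingroup.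
From mathcomp Require Import finmap.
From mathcomp Require Import zify.
From Stdlib Require Import Permutation Classical.

(* Fix bases [c] of [J1] and [d] of [J2].  The map sends [rho] to its
   restrictions [t |-> rho (d t)] and [u |-> rho (c u)].  Two bases [a x], [a x']
   of [J1] and two bases [b y], [b y'] of [J2] give a three-term Pluecker
   relation one of whose terms vanishes, which says that the 2 x 2 minor of
   [(u, t) |-> rho (u t)] at these rows and columns is zero; since exchange moves
   connect all bases, every 2 x 2 minor is zero.  So [rho] is determined, up to a
   scalar, by its restrictions.  Conversely [rho1] and [rho2] are glued to
   [w |-> +- rho1 (w_left) rho2 (w_right)], the sign being that of the
   permutation sorting the left letters of [w] before the right ones: in a
   Pluecker relation only the terms moving left letters, or only those moving
   right letters, survive, and these form a multiple of a relation of [rho1] or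
   [rho2]. *)

Set Implicit Arguments.
Unset Strict Implicit.
Unset Printing Implicit Defensive.

(** * Tracts *)

Section Tract.
Variable F : tract.
Implicit Types (x y z : F) (s t : seq F).

(** Signs are indexed by parity, so that products of signs become [addb] and sign identities become
    boolean ones. *)
Definition sg (b : bool) : F := if b then teps else tone.

Lemma tmulx1 x : tmul x tone = x.
Proof. by rewrite tmulC tmul1. Qed.

Lemma tmulx0 x : tmul x tzero = tzero.
Proof. by rewrite tmulC tmul0. Qed.

Lemma tmulCA x y z : tmul x (tmul y z) = tmul y (tmul x z).
Proof. by rewrite !tmulA (tmulC x). Qed.

Lemma tmulACA x y z w :
  tmul (tmul x y) (tmul z w) = tmul (tmul x z) (tmul y w).
Proof. by rewrite -!tmulA [tmul y _]tmulCA. Qed.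

Lemma tmul_nz x y : tmul x y <> tzero <-> x <> tzero /\ y <> tzero.
Proof.
split=> [nz | [] /tmul_neq0]; last exact.
by split=> e; apply: nz; rewrite e ?tmul0 ?tmulx0.
Qed.

Lemma tmul_cancel z x y : z <> tzero -> tmul z x = tmul z y -> x = y.
Proof.
case/tinv=> w zw e; rewrite -(tmul1 x) -(tmul1 y) -zw (tmulC z).
by rewrite -!tmulA e.
Qed.

(** Proportionality of the pairs (a, b), (c, d), (e, g) is transitive when the middle pair has
    nonzero entries: multiply by [tmul d c] and cancel. This is how vanishing minors are chained. *)
Lemma tmul_cross a b c d e g : c <> tzero -> d <> tzero ->
  tmul a d = tmul b c -> tmul c g = tmul d e -> tmul a g = tmul b e :> F.
Proof.
move=> c_nz d_nz adbc cgde; apply: (@tmul_cancel (tmul d c)).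
  exact: tmul_neq0.
rewrite tmulACA (tmulC d) adbc cgde (tmulC b) tmulACA.
by rewrite (tmulC c d).
Qed.

Lemma tnull_opp x : tnull [:: x; tmul teps x].
Proof. by have:= tnull_mul x (tnull_eps F); rewrite /= tmulx1 (tmulC x). Qed.

Lemma tnull_swap x y : tnull [:: x; y] -> @tnull F [:: y; x].
Proof. by apply: tnull_perm; apply: perm_swap. Qed.

Lemma tnull_opp_inj x y : tnull [:: x; tmul teps y] -> x = y.
Proof.
move=> nxy; have nyy := tnull_opp y.
have [z [_ z_uniq]] := tnull_inv (tmul teps y).
by rewrite -(z_uniq x) ?(z_uniq y) //; apply: tnull_swap.
Qed.

(** Both sides are additive inverses of [teps]. *)
Lemma teps2 : tmul teps teps = tone :> F.
Proof.
have [z [_ z_uniq]] := tnull_inv (@teps F).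
rewrite -(z_uniq _ (tnull_opp teps)); apply: z_uniq.
exact/tnull_swap/tnull_eps.
Qed.

Lemma sgD a b : tmul (sg a) (sg b) = sg (a (+) b).
Proof. by case: a b => [] []; rewrite /= ?teps2 ?tmul1 ?tmulx1. Qed.

Lemma sgK b x : tmul (sg b) (tmul (sg b) x) = x.
Proof. by rewrite tmulA sgD addbb tmul1. Qed.

Lemma sg_nz b : sg b <> tzero.
Proof.
move=> e; apply: (@tone_neq0 F).
by rewrite -(sgK b tone) e tmul0.
Qed.

Lemma sg_mul_nz b x : tmul (sg b) x <> tzero <-> x <> tzero.
Proof. by split=> [/tmul_nz[] // | nz]; apply/tmul_nz; split=> //; apply: sg_nz. Qed.

Lemma sg_collect a b d (x1 x2 y1 y2 : F) :
  tmul (sg a) (tmul (tmul (sg b) (tmul x1 y1)) (tmul (sg d) (tmul x2 y2)))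
  = tmul (sg (a (+) b (+) d)) (tmul (tmul x1 x2) (tmul y1 y2)).
Proof. by rewrite [X in tmul (sg a) X]tmulACA sgD tmulA sgD addbA (tmulACA x1). Qed.

Lemma sg_factor a b (x y : F) :
  tmul (tmul (sg a) y) (tmul (sg b) x) = tmul (sg (a (+) b)) (tmul x y).
Proof. by rewrite tmulACA sgD (tmulC y). Qed.

Lemma sg_mul2 b x y : tmul (tmul (sg b) x) (tmul (sg b) y) = tmul x y.
Proof. by rewrite tmulACA sgD addbb tmul1. Qed.

Lemma tsignE k : tsign F k = sg (odd k).
Proof.
elim: k => //= k; rewrite /tsign /= => ->.
by rewrite -[teps]/(sg true) sgD.
Qed.

End Tract.

(** * Alternating functions and Pluecker terms on words *)

Section Words.
Variable T : Type.
Implicit Types a b c w : seq T.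

Definition alt_fun (F : tract) (f : seq T -> F) : Prop :=
  forall a x y b, f (a ++ y :: x :: b) = tmul teps (f (a ++ x :: y :: b)).

Lemma alt_funE (F : tract) (f : seq T -> F) a b x y : alt_fun f ->
  f (a ++ y :: x :: b) = tmul (sg F true) (f (a ++ x :: y :: b)).
Proof. exact. Qed.

Lemma alt_rot1 (F : tract) (f : seq T -> F) a b c x : alt_fun f ->
  f (a ++ b ++ x :: c) = tmul (sg F (odd (size b))) (f (a ++ x :: b ++ c)).
Proof.
move=> af; elim: b a => [|y b IH] a /=; first by rewrite tmul1.
by rewrite -cat_rcons IH cat_rcons (alt_funE _ _ _ _ af) tmulA sgD addbT.
Qed.

Lemma alt_catCA (F : tract) (f : seq T -> F) a b c w : alt_fun f ->
  f (a ++ c ++ b ++ w) =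
    tmul (sg F (odd (size b * size c))) (f (a ++ b ++ c ++ w)).
Proof.
move=> af; elim: b a => [|y b IH] a /=; first by rewrite tmul1.
rewrite alt_rot1 // -[y :: c ++ _]cat1s catA IH -catA tmulA sgD.
by rewrite mulSn oddD.
Qed.

(** Moving the second letter back across [b] costs the same sign on both sides, which leaves one
    adjacent swap. *)
Lemma alt_swap_far (F : tract) (f : seq T -> F) a b c x y : alt_fun f ->
  f (a ++ y :: b ++ x :: c) = tmul teps (f (a ++ x :: b ++ y :: c)).
Proof.
move=> af; have := alt_rot1 (rcons a y) b c x af; rewrite !cat_rcons => ->.
have := alt_rot1 (rcons a x) b c y af; rewrite !cat_rcons => ->.
by rewrite (af a) tmulCA.
Qed.

(* The terms of a Pluecker relation are [pterms f al j [::] i]; in the recursion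
   [pre] holds the letters that have already been passed. *)
Fixpoint pterms (F : tract) (f : seq T -> F) (al j pre i : seq T) : seq F :=
  if i is x :: i' then
    tmul (sg F (odd (size pre))) (tmul (f (al ++ pre ++ i')) (f (al ++ x :: j)))
    :: pterms f al j (rcons pre x) i'
  else [::].

End Words.

Lemma alt_comp (S T : Type) (F : tract) (f : seq T -> F) (phi : S -> T) (v v' : seq T) :
  alt_fun f -> alt_fun (fun u => f (v ++ map phi u ++ v')).
Proof.
by move=> af a x y b; rewrite !map_cat /= -!catA !(catA v) /= af.
Qed.

(** Block exchanges generate all rearrangements. The sign is chosen before [F] and [f], so one [e]
    serves several alternating functions at once. *)
Lemma perm_sign (T : eqType) (w w' : seq T) : perm_eq w w' ->
  exists e, forall (F : tract) (f : seq T -> F), alt_fun f -> f w' = tmul (sg F e) (f w).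
Proof.
move=> pw; pose P (v : seq T) := exists e,
  forall (F : tract) (f : seq T -> F), alt_fun f -> f v = tmul (sg F e) (f w).
apply: (catCA_perm_ind (P := P) _ pw); last first.
  by exists false => F f _; rewrite tmul1.
move=> s1 s2 s3 [e ef]; exists (odd (size s1 * size s2) (+) e) => F f af.
have /= -> := alt_catCA [::] s1 s2 s3 af.
by rewrite ef // tmulA sgD.
Qed.

Lemma pterms_map (S T : Type) (F : tract) (f : seq T -> F) (phi : S -> T) v
    al j pre i :
  pterms (fun w => f (v ++ map phi w)) al j pre i =
  pterms f (v ++ map phi al) (map phi j) (map phi pre) (map phi i).
Proof.
elim: i pre => //= x i IH pre.
by rewrite IH map_rcons !map_cat -!catA size_map.
Qed.

(* Letters outside the domain of [p] contribute zero terms, the others give the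
   terms of [f] up to a common factor. *)
Lemma tnull_pterms_pmap (A B : Type) (p : A -> option B) (F : tract)
    (g : seq A -> F) (f : seq B -> F) al j full (c : F) :
  (forall pre x i, full = pre ++ x :: i ->
     tmul (sg F (odd (size pre))) (tmul (g (al ++ pre ++ i)) (g (al ++ x :: j)))
     = if p x is Some y then
         tmul c (tmul (sg F (odd (size (pmap p pre))))
           (tmul (f (pmap p al ++ pmap p pre ++ pmap p i))
                 (f (pmap p al ++ y :: pmap p j))))
       else tzero) ->
  tnull (pterms f (pmap p al) (pmap p j) [::] (pmap p full)) ->
  tnull (pterms g al j [::] full).
Proof.
move=> gf /(tnull_mul c).
(* [acc] collects the terms of [g] already treated; the remaining terms are replaced one letter at a
   time. *)
suff H acc pre i : full = pre ++ i ->
    tnull (acc ++ map (tmul c)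
      (pterms f (pmap p al) (pmap p j) (pmap p pre) (pmap p i))) ->
    tnull (acc ++ pterms g al j pre i).
  by apply: (H [::] [::]).
elim: i pre acc => //= x i IH pre acc e.
rewrite (gf _ _ _ e) -cat_rcons; have e' : full = rcons pre x ++ i by rewrite cat_rcons.
case Ex: (p x) => [y|] /= nf; apply: IH e' _.
  by rewrite -[rcons pre x]cats1 pmap_cat /= Ex /= cats1 cat_rcons.
rewrite -[rcons pre x]cats1 pmap_cat /= Ex /= cats0 cat_rcons.
(* A zero term can be inserted anywhere, by moving it to the front and using [tnull_zero]. *)
have perm0 : Permutation (tzero :: acc ++ map (tmul c)
    (pterms f (pmap p al) (pmap p j) (pmap p pre) (pmap p i)))
  (acc ++ tzero :: map (tmul c)
    (pterms f (pmap p al) (pmap p j) (pmap p pre) (pmap p i))).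
  exact: Permutation_middle.
by apply: tnull_perm perm0 _; apply/tnull_zero.
Qed.

(** Here s is [(size j).+1], and s = 1 is allowed: relations of this length arise when only the
    letters of one summand are kept. [plucker_tev] shows that they hold automatically. *)
Definition plucker_fun (F : tract) n m (om : 'I_n -> nat) (f : seq 'I_n -> F) :=
  forall (al i j : seq 'I_n), size i = (size j).+2 -> size al + (size j).+1 = m ->
    (forall x, count_mem x (al ++ i ++ j) <= om x) ->
    tnull (pterms f al j [::] i).

(* Strong representations as functions on all words; the bases [B] have length
   [m], so such a function vanishes on words of any other length. *)
Definition strong_fun (F : tract) n m (B : seq 'I_n -> Prop) (om : 'I_n -> nat)
    (f : seq 'I_n -> F) : Prop :=
  [/\ forall w, f w <> tzero <-> B w, alt_fun f & plucker_fun m om f].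

Lemma strong_fun_eq0 (F : tract) n m B om (f : seq 'I_n -> F) w :
  strong_fun m B om f -> ~ B w -> f w = tzero.
Proof. by case=> supp _ _ nB; apply: NNPP => /supp. Qed.

Lemma strong_restrict (F : tract) n n' m m' B B' om om' (f : seq 'I_n -> F)
    (phi : 'I_n' -> 'I_n) v :
  size v + m' = m ->
  (forall w, B (v ++ map phi w) <-> B' w) ->
  (forall w, (forall x, count_mem x w <= om' x) ->
     forall x, count_mem x (v ++ map phi w) <= om x) ->
  strong_fun m B om f -> strong_fun m' B' om' (fun w => f (v ++ map phi w)).
Proof.
move=> sz BB' omom' [supp af pf]; split.
- by move=> w; rewrite supp.
- by move=> a x y b; rewrite !map_cat /= !catA af.
move=> al i j sij sal cnts; rewrite pterms_map; apply: pf.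
- by rewrite !size_map.
- by rewrite size_cat !size_map -addnA sal.
by move=> x; rewrite -catA -!map_cat; apply: omom'.
Qed.

(** * Gluing *)

Section Glue.
Variables n1 n2 : nat.
Implicit Types a b w : seq 'I_(n1 + n2).

Definition to_left (k : 'I_(n1 + n2)) : option 'I_n1 :=
  if split k is inl i then Some i else None.
Definition to_right (k : 'I_(n1 + n2)) : option 'I_n2 :=
  if split k is inr i then Some i else None.

Notation L := (pmap to_left).
Notation R := (pmap to_right).

(* The parity of the permutation sorting the letters of [w] into left letters
   followed by right letters. *)
Fixpoint inv_parity w : bool :=
  if w is k :: w' then
    (to_right k && odd (size (L w'))) (+) inv_parity w'
  else false.

Local Ltac parity_cases :=
  repeat match goal with
  | |- context [odd ?x] => case: (odd x)
  | |- context [inv_parity ?w] => case: (inv_parity w)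
  end; by [].

(** The inversions between [a] and [b] pair a right letter of [a] with a left letter of [b]. *)
Lemma inv_parity_cat a b :
  inv_parity (a ++ b) =
    inv_parity a (+) inv_parity b (+) (odd (size (R a)) && odd (size (L b))).
Proof.
elim: a => [|k a IH] /=; first by rewrite addbF.
rewrite {}IH pmap_cat size_cat oddD.
by case: (to_right k) => [r|] /=; parity_cases.
Qed.

Lemma to_left_lshift i : to_left (lshift n2 i) = Some i.
Proof. by rewrite /to_left (unsplitK (inl i)). Qed.
Lemma to_left_rshift i : to_left (rshift n1 i) = None.
Proof. by rewrite /to_left (unsplitK (inr i)). Qed.
Lemma to_right_lshift i : to_right (lshift n2 i) = None.
Proof. by rewrite /to_right (unsplitK (inl i)). Qed.
Lemma to_right_rshift i : to_right (rshift n1 i) = Some i.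
Proof. by rewrite /to_right (unsplitK (inr i)). Qed.
Definition to_E :=
  (to_left_lshift, to_left_rshift, to_right_lshift, to_right_rshift).

Lemma letterP k : {i | k = lshift n2 i} + {i | k = rshift n1 i}.
Proof.
by rewrite -(splitK k); case: (split k) => i; [left | right]; exists i.
Qed.

Lemma size_LR w : size w = size (L w) + size (R w).
Proof.
by elim: w => //= k w ->; case: (letterP k) => -[i ->]; rewrite !to_E /= ?addnS.
Qed.

Lemma count_L i w : count_mem i (L w) = count_mem (lshift n2 i) w.
Proof.
elim: w => //= k w <-; case: (letterP k) => -[l ->]; rewrite !to_E /=.
  by rewrite (inj_eq (@lshift_inj _ _)).
by rewrite eq_rlshift.
Qed.

Lemma count_R i w : count_mem i (R w) = count_mem (rshift n1 i) w.
Proof.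
elim: w => //= k w <-; case: (letterP k) => -[l ->]; rewrite !to_E /=.
  by rewrite eq_lrshift.
by rewrite (inj_eq (@rshift_inj _ _)).
Qed.

Variables (F : tract) (f1 : seq 'I_n1 -> F) (f2 : seq 'I_n2 -> F).
Variables (m1 m2 : nat) (B1 : seq 'I_n1 -> Prop) (B2 : seq 'I_n2 -> Prop).
Variables (om1 : 'I_n1 -> nat) (om2 : 'I_n2 -> nat).
Hypotheses (sB1 : forall t, B1 t -> size t = m1)
  (sB2 : forall u, B2 u -> size u = m2).
Hypotheses (sf1 : strong_fun m1 B1 om1 f1) (sf2 : strong_fun m2 B2 om2 f2).

Definition glue w : F :=
  tmul (sg F (inv_parity w)) (tmul (f1 (L w)) (f2 (R w))).

Let glue_nz w : glue w <> tzero <-> B1 (L w) /\ B2 (R w).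
Proof.
by case: sf1 sf2 => s1 _ _ [s2 _ _]; rewrite sg_mul_nz tmul_nz s1 s2.
Qed.

(** Swapping neighbours from the same side alters one subword and keeps the parity; swapping
    neighbours from different sides alters only the parity. *)
Let glue_alt : alt_fun glue.
Proof.
case: sf1 sf2 => _ a1 _ [_ a2 _] a x y b.
rewrite /glue !inv_parity_cat !pmap_cat /=.
case: (letterP x) (letterP y) => -[i ->] [[j ->]|[j ->]]; rewrite !to_E /=.
- by rewrite a1 -!tmulA tmulCA.
- set e1 := _ (+) _; set e2 := _ (+) _.
  have -> : e1 = true (+) e2.
    by rewrite /e1 /e2 /=; parity_cases.
  by rewrite -sgD -tmulA.
- set e1 := _ (+) _; set e2 := _ (+) _.
  have -> : e1 = true (+) e2.
    by rewrite /e1 /e2 /=; parity_cases.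
  by rewrite -sgD -tmulA.
- by rewrite a2 !(tmulCA teps).
Qed.

Let glue_eq0 w : size (L w) <> m1 \/ size (R w) <> m2 -> glue w = tzero.
Proof.
move=> sz; apply: NNPP => /glue_nz[/sB1 s1 /sB2 s2].
by case: sz; [rewrite s1 | rewrite s2].
Qed.

(** Counting letters decides which terms survive: a nonzero term moving a left letter forces [inA],
    one moving a right letter forces [inB]. The two exclude each other, since together they would
    make [al ++ i] one letter too long. *)
Lemma glue_plucker om :
  (forall i, om (lshift n2 i) = om1 i) -> (forall i, om (rshift n1 i) = om2 i) ->
  plucker_fun (m1 + m2) om glue.
Proof.
move=> omL omR al i j sij sal cnts.
have sLR := (size_LR i, size_LR j, size_LR al).
have sL := (pmap_cat, size_cat, to_E).
pose inA := (size (L al) + size (L i) == m1.+1) && (size (L al) + (size (L j)).+1 == m1).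
pose inB := (size (R al) + size (R i) == m2.+1) && (size (R al) + (size (R j)).+1 == m2).
case: (boolP inA) => [/andP[/eqP eA1 /eqP eA2] | nA].
  (* The right subwords do not change when a left letter moves, so their values and the remaining
     sign form a common factor. *)
  pose c := tmul (sg F (inv_parity (al ++ i) (+) inv_parity al (+) inv_parity j
      (+) (odd (size (R al)) && odd (size (L j)))))
    (tmul (f2 (R al ++ R i)) (f2 (R al ++ R j))).
  apply: (@tnull_pterms_pmap _ _ to_left _ _ f1 _ _ _ c) => [pre x i' ei|].
    case: (letterP x) => -[y ex]; rewrite ex !to_E.
      rewrite /glue sg_collect /c sg_factor ei ex !pmap_cat /= !to_E /=.
      congr (tmul (sg F _) _); rewrite (size_LR pre) !inv_parity_cat /= !sL /= !sL /= !oddD /=.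
      by parity_cases.
    rewrite [glue (al ++ pre ++ i')]glue_eq0 ?tmul0 ?tmulx0 //; left.
    rewrite ei ex !sL /= !sL /= in eA1; rewrite !sL; lia.
  case: (sf1) => _ _; apply.
  - lia.
  - lia.
  by move=> x; rewrite -!pmap_cat count_L -omL.
case: (boolP inB) => [/andP[/eqP eB1 /eqP eB2] | nB].
  (* A moved right letter is inverted with the left letters after it in [i]; together with those of
     [pre], counted in [size pre], they give [L i]. Placed before [j], it is inverted with all of
     [L j]. *)
  pose c := tmul (sg F (inv_parity (al ++ i) (+) inv_parity al (+) inv_parity j
      (+) (odd (size (R al)) && odd (size (L j)))
      (+) odd (size (L i)) (+) odd (size (L j))))
    (tmul (f1 (L al ++ L i)) (f1 (L al ++ L j))).
  apply: (@tnull_pterms_pmap _ _ to_right _ _ f2 _ _ _ c) => [pre x i' ei|].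
    case: (letterP x) => -[y ex]; rewrite ex !to_E; last first.
      rewrite /glue sg_collect /c sg_factor ei ex !pmap_cat /= !to_E /=.
      rewrite (tmulC (tmul (f2 _) _)).
      congr (tmul (sg F _) _); rewrite (size_LR pre) !inv_parity_cat /= !sL /= !sL /= !oddD /=.
      by parity_cases.
    rewrite [glue (al ++ pre ++ i')]glue_eq0 ?tmul0 ?tmulx0 //; right.
    rewrite ei ex !sL /= !sL /= in eB1; rewrite !sL; lia.
  case: (sf2) => _ _; apply.
  - lia.
  - lia.
  by move=> x; rewrite -!pmap_cat count_R -omR.
(* With neither count right every term is zero; [p0] discards all letters, which leaves the empty
   relation. *)
pose p0 := fun _ : 'I_(n1 + n2) => None : option 'I_n1.
apply: (@tnull_pterms_pmap _ _ p0 _ _ f1 _ _ _ tone) => [pre x i' ei|]; last first.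
  have -> : pmap p0 i = [::] by elim: (i).
  exact: tnull_nil.
have [//|/glue_nz[/sB1 s1 /sB2 s2]] := classic (glue (al ++ pre ++ i') = tzero).
  by move=> ->; rewrite tmul0 tmulx0.
have [//|/glue_nz[/sB1 t1 /sB2 t2]] := classic (glue (al ++ x :: j) = tzero).
  by move=> ->; rewrite !tmulx0.
move: nA nB; rewrite /inA /inB ei; move: s1 s2 t1 t2.
by case: (letterP x) => -[y ->]; rewrite !sL /= !sL /=; lia.
Qed.

Lemma glue_strong om B :
  (forall w, B w <-> B1 (L w) /\ B2 (R w)) ->
  (forall i, om (lshift n2 i) = om1 i) -> (forall i, om (rshift n1 i) = om2 i) ->
  strong_fun (m1 + m2) B om glue.
Proof.
move=> BE omL omR; split; [|exact: glue_alt | exact: glue_plucker].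
by move=> w; rewrite BE.
Qed.

End Glue.

(** * Bases of M-convex sets *)

Lemma cntE n (w : seq 'I_n) i : cnt w i = count_mem i w.
Proof. by rewrite ffunE. Qed.

Lemma exchE n (a : vec n) i j k : exch a i j k = a k + (k == j) - (k == i).
Proof. by rewrite ffunE. Qed.

Section Bases.
Variables (n : nat) (J : {fset vec n}).
Implicit Types (a b : vec n) (t w : seq 'I_n).

Definition basis (w : seq 'I_n) : Prop := in_Jbar J (cnt w).

Lemma leq_dmax a i : a \in J -> a i <= dmax J i.
Proof. by move=> aJ; rewrite ffunE (leq_bigmax_seq _ aJ). Qed.

Lemma dmin_leq a i : a \in J -> dmin J i <= a i.
Proof.
rewrite ffunE -[a \in J]/(a \in (J : seq _)); elim: (J : seq _) => //= b s IH.
rewrite inE big_cons geq_min => /predU1P[-> | /IH ->]; first by rewrite leqnn.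
exact: orbT.
Qed.

Lemma dmax_attained i : J != fset0 -> exists2 a, a \in J & a i = dmax J i.
Proof.
case/fset0Pn=> a0 a0J.
have: dmax J i = 0 \/ exists2 a, a \in J & a i = dmax J i.
  rewrite ffunE; set P := fun s : seq (vec n) => \max_(a <- s) a i = 0 \/
    exists2 a, a \in s & a i = \max_(a <- s) a i.
  suff: P J by [].
  elim: (J : seq _) => [|b s]; rewrite /P ?big_nil ?big_cons; [by left | move=> IH].
  right; case: (leqP (\max_(a <- s) a i) (b i)) => le_s.
    by exists b; rewrite ?mem_head.
  case: IH => [e0 | [a ain ae]]; first by rewrite e0 in le_s.
  by exists a; rewrite // inE ain orbT.
(* If the maximum is the default 0 of the empty list, any member of [J] attains it. *)
case=> // e0; exists a0 => //; apply/eqP.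
by rewrite eqn_leq leq_dmax // e0.
Qed.

Lemma dmin_attained i : J != fset0 -> exists2 a, a \in J & a i = dmin J i.
Proof.
case/fset0Pn=> a0 a0J.
have: dmin J i = dmax J i \/ exists2 a, a \in J & a i = dmin J i.
  rewrite ffunE; set P := fun s : seq (vec n) =>
    \big[minn/dmax J i]_(a <- s) a i = dmax J i \/
    exists2 a, a \in s & a i = \big[minn/dmax J i]_(a <- s) a i.
  suff: P J by [].
  elim: (J : seq _) => [|b s]; rewrite /P ?big_nil ?big_cons; [by left | move=> IH].
  case: (leqP (b i) (\big[minn/dmax J i]_(a <- s) a i)) => le_s.
    by right; exists b; rewrite ?mem_head.
  case: IH => [e0 | [a ain ae]]; first by left.
  by right; exists a; rewrite // inE ain orbT.
(* If the minimum is the default [dmax J i], every member is squeezed between [dmin] and [dmax]. *)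
case=> // e0; exists a0 => //; apply/eqP.
by rewrite eqn_leq dmin_leq // andbT e0 leq_dmax.
Qed.

Lemma dmax_eq i x : (forall a, a \in J -> a i <= x) ->
  (exists2 a, a \in J & a i = x) -> dmax J i = x.
Proof.
move=> le_x [a aJ ax]; apply/eqP; rewrite eqn_leq -{2}ax leq_dmax // andbT.
by case: (@dmax_attained i) => [|b bJ <-]; [apply/fset0Pn; exists a | apply: le_x].
Qed.

Lemma dmin_eq i x : (forall a, a \in J -> x <= a i) ->
  (exists2 a, a \in J & a i = x) -> dmin J i = x.
Proof.
move=> ge_x [a aJ ax]; apply/eqP; rewrite eqn_leq -{1}ax dmin_leq //=.
by case: (@dmin_attained i) => [|b bJ <-]; [apply/fset0Pn; exists a | apply: ge_x].
Qed.

Lemma basis_perm t t' : perm_eq t t' -> basis t -> basis t'.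
Proof.
by move/seq.permP=> p [a aJ e]; exists a => // i; rewrite e !cntE p.
Qed.

Lemma basis_leq_omega w x : basis w -> count_mem x w <= omega J x.
Proof.
case=> a aJ /(_ x); rewrite cntE [omega _ _]ffunE => <-.
exact/leq_sub2r/leq_dmax.
Qed.

Lemma basis_exists : J != fset0 -> exists w, basis w.
Proof.
case/fset0Pn=> a aJ.
exists (flatten [seq nseq (a i - dmin J i) i | i <- enum 'I_n]).
exists a => // i; rewrite cntE count_flatten -map_comp sumnE big_map big_enum.
rewrite (bigD1 i) //= count_nseq /= eqxx mul1n big1 ?addn0 // => k /negPf ki.
by rewrite count_nseq /= ki.
Qed.

Variable r : nat.

Lemma sum_dmin_leq : J != fset0 -> in_simplex r J -> \sum_i dmin J i <= r.
Proof.
by case/fset0Pn=> a aJ /(_ a aJ) <-; apply: leq_sum => i _; apply: dmin_leq.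
Qed.

Lemma basis_size w : in_simplex r J -> basis w -> size w = rbar r J.
Proof.
move=> sJ [a aJ e]; have -> : size w = \sum_i cnt w i.
  transitivity (\sum_(i < n) count_mem i w); last first.
    by apply: eq_bigr => i _; rewrite cntE.
  elim: w {e} => [|k w IH] /=; first by rewrite big1.
  rewrite big_split /= -IH (bigD1 k) //= eqxx big1 // => i /negPf.
  by rewrite eq_sym => ->.
rewrite /rbar -(sJ a aJ) -sumnB => [|i _]; last exact: dmin_leq.
by apply: eq_bigr => i _; rewrite e.
Qed.

(* Exchange moves connect any two bases, the distance to the target decreasing
   at each step. *)
Lemma basis_connected (Pr : seq 'I_n -> seq 'I_n -> Prop) : Mconvex r J ->
  (forall t t', basis t -> perm_eq t t' -> Pr t t') ->
  (forall al x x', basis (rcons al x) -> basis (rcons al x') ->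
     Pr (rcons al x) (rcons al x')) ->
  (forall t t' t'', basis t -> basis t' -> basis t'' ->
     Pr t t' -> Pr t' t'' -> Pr t t'') ->
  forall t t', basis t -> basis t' -> Pr t t'.
Proof.
case=> _ sJ exJ Pperm Pstep Ptrans t t' Bt Bt'; have [b bJ eb] := Bt'.
(* The induction is on the total excess of the vector of [t] over the target [b]. *)
have [N] := ubnP (\sum_i ((cnt t i + dmin J i) - b i)).
elim: N t Bt => // N IH t Bt; have [a aJ ea] := Bt.
have ca k : a k = count_mem k t + dmin J k.
  by have := ea k; rewrite cntE => <-; rewrite subnK ?dmin_leq.
have cb k : b k = count_mem k t' + dmin J k.
  by have := eb k; rewrite cntE => <-; rewrite subnK ?dmin_leq.
rewrite ltnS => le_N; case: (pickP (fun i => b i < a i)) => [i lti | geb].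
  have [j [ltj exj]] := exJ a b i aJ bJ lti.
  have nij : j != i by apply: contraTneq ltj => ->; rewrite -leqNgt ltnW.
  (* [a i] exceeds [b i], which is at least [dmin J i], so [i] occurs in the reduced word. *)
  have it : i \in t.
    rewrite -has_pred1 has_count; have := lti.
    by rewrite ca cb ltn_add2r; apply: leq_ltn_trans.
  have pt : perm_eq t (rcons (rem i t) i).
    by rewrite perm_sym perm_rcons perm_sym perm_to_rem.
  have ct k : count_mem k (rcons (rem i t) j) = count_mem k t + (k == j) - (k == i).
    rewrite -cats1 count_cat /= addn0 count_rem it /= ![_ == k]eq_sym.
    case: (k =P i) => [->|_]; last by rewrite !subn0.
    have: 0 < count_mem i t by rewrite -has_count has_pred1.
    have /negPf-> : i != j by rewrite eq_sym.
    lia.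
  have Bt2 : basis (rcons (rem i t) j).
    exists (exch a i j) => // k; rewrite ?cntE ?exchE ct ca.
    by case: (k =P j) (k =P i) => [->|_] [ki|_] /=; rewrite ?ki ?eqxx in nij *; lia.
  apply: (Ptrans _ (rcons (rem i t) i)) => //; [exact: basis_perm Bt|exact: Pperm|].
  apply: (Ptrans _ (rcons (rem i t) j)) => //; [exact: basis_perm Bt| |].
    by apply: Pstep => //; exact: basis_perm Bt.
  apply: IH => //; apply: leq_trans le_N.
  (* The excess drops by one at [i] and stays zero at [j], where [a j < b j]. *)
  rewrite (bigD1 i) //= [X in _ < X](bigD1 i) //= -addSn leq_add //.
    have /negPf nij' : i != j by rewrite eq_sym.
    move: lti; rewrite !cntE ct eqxx nij' ca cb; lia.
  apply: leq_sum => k ki; rewrite !cntE ct (negPf ki).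
  case: (k =P j) => [->|_] /=; last lia.
  have: count_mem j t + dmin J j < b j by rewrite -ca.
  rewrite addn1 subn0 addSn => lt_b.
  by rewrite (eqP (_ : _ - b j == 0)) // subn_eq0.
apply: Pperm => //; apply/allP => k _ /=.
(* Without excess, [a] lies below [b] with the same coordinate sum, hence they agree and the words
   are rearrangements of each other. *)
have le_ab l : a l <= b l by rewrite leqNgt geb.
have := (leqif_sum (fun l (_ : true) => leqif_eq (le_ab l))).2.
rewrite (sJ a aJ) (sJ b bJ) eqxx => /esym/forallP/(_ k).
by rewrite ca cb eqn_add2r.
Qed.

End Bases.

(** * Direct sums *)

Section DirectSum.
Variables (n1 n2 r1 r2 : nat) (J1 : {fset vec n1}) (J2 : {fset vec n2}).
Hypotheses (MJ1 : Mconvex r1 J1) (MJ2 : Mconvex r2 J2).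
Notation J := (dsum J1 J2).
Notation L := (pmap (@to_left n1 n2)).
Notation R := (pmap (@to_right n1 n2)).
Notation inl := (map (@lshift n1 n2)).
Notation inr := (map (@rshift n1 n2)).
Implicit Types (t : seq 'I_n1) (u : seq 'I_n2) (w : seq 'I_(n1 + n2)).

Let J1_neq0 : J1 != fset0. Proof. by case: MJ1. Qed.
Let J2_neq0 : J2 != fset0. Proof. by case: MJ2. Qed.
Let sJ1 : in_simplex r1 J1. Proof. by case: MJ1. Qed.
Let sJ2 : in_simplex r2 J2. Proof. by case: MJ2. Qed.

Lemma vcat_lshift (a : vec n1) (b : vec n2) i : vcat a b (lshift n2 i) = a i.
Proof. by rewrite ffunE (unsplitK (Datatypes.inl i)). Qed.

Lemma vcat_rshift (a : vec n1) (b : vec n2) i : vcat a b (rshift n1 i) = b i.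
Proof. by rewrite ffunE (unsplitK (Datatypes.inr i)). Qed.

Definition vcatE := (vcat_lshift, vcat_rshift).

Lemma dsumP (c : vec (n1 + n2)) :
  c \in J <-> exists a b, [/\ a \in J1, b \in J2 & c = vcat a b].
Proof.
split=> [/imfset2P[a /= aJ [b /= bJ ->]] | [a [b [aJ bJ ->]]]].
  by exists a, b.
exact: in_imfset2.
Qed.

Let mem_dsum a b : a \in J1 -> b \in J2 -> vcat a b \in J.
Proof. by move=> aJ bJ; apply/dsumP; exists a, b. Qed.

Lemma sum_vcat (c : vec (n1 + n2)) :
  \sum_i c i = \sum_i c (lshift n2 i) + \sum_i c (rshift n1 i).
Proof. exact: big_split_ord. Qed.

Lemma dsum_in_simplex : in_simplex (r1 + r2) J.
Proof.
move=> c /dsumP[a [b [aJ bJ ->]]]; rewrite sum_vcat -(sJ1 aJ) -(sJ2 bJ).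
by congr (_ + _); apply: eq_bigr => i _; rewrite vcatE.
Qed.

Lemma dmax_lshift i : dmax J (lshift n2 i) = dmax J1 i.
Proof.
apply: dmax_eq => [c /dsumP[a [b [aJ bJ ->]]] |].
  by rewrite vcatE leq_dmax.
have [a aJ <-] := dmax_attained i J1_neq0; have /fset0Pn[b bJ] := J2_neq0.
by exists (vcat a b); rewrite ?vcatE ?mem_dsum.
Qed.

Lemma dmax_rshift i : dmax J (rshift n1 i) = dmax J2 i.
Proof.
apply: dmax_eq => [c /dsumP[a [b [aJ bJ ->]]] |].
  by rewrite vcatE leq_dmax.
have [b bJ <-] := dmax_attained i J2_neq0; have /fset0Pn[a aJ] := J1_neq0.
by exists (vcat a b); rewrite ?vcatE ?mem_dsum.
Qed.

Lemma dmin_lshift i : dmin J (lshift n2 i) = dmin J1 i.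
Proof.
apply: dmin_eq => [c /dsumP[a [b [aJ bJ ->]]] |].
  by rewrite vcatE dmin_leq.
have [a aJ <-] := dmin_attained i J1_neq0; have /fset0Pn[b bJ] := J2_neq0.
by exists (vcat a b); rewrite ?vcatE ?mem_dsum.
Qed.

Lemma dmin_rshift i : dmin J (rshift n1 i) = dmin J2 i.
Proof.
apply: dmin_eq => [c /dsumP[a [b [aJ bJ ->]]] |].
  by rewrite vcatE dmin_leq.
have [b bJ <-] := dmin_attained i J2_neq0; have /fset0Pn[a aJ] := J1_neq0.
by exists (vcat a b); rewrite ?vcatE ?mem_dsum.
Qed.

Lemma omega_lshift i : omega J (lshift n2 i) = omega J1 i.
Proof. by rewrite ffunE dmax_lshift dmin_lshift [RHS]ffunE. Qed.

Lemma omega_rshift i : omega J (rshift n1 i) = omega J2 i.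
Proof. by rewrite ffunE dmax_rshift dmin_rshift [RHS]ffunE. Qed.

Lemma rbar_dsum : rbar (r1 + r2) J = rbar r1 J1 + rbar r2 J2.
Proof.
have le1 := sum_dmin_leq J1_neq0 sJ1; have le2 := sum_dmin_leq J2_neq0 sJ2.
rewrite /rbar sum_vcat; under eq_bigr do rewrite dmin_lshift.
under [X in _ - (_ + X)]eq_bigr do rewrite dmin_rshift.
by rewrite subnDA -addnBAC // -addnBA.
Qed.

Lemma basis_dsum w : basis J w <-> basis J1 (L w) /\ basis J2 (R w).
Proof.
split=> [[c /dsumP[a [b [aJ bJ ->]]] e] | [[a aJ ea] [b bJ eb]]].
  split; [exists a => // i | exists b => // i].
    by rewrite cntE count_L -cntE -e vcatE dmin_lshift.
  by rewrite cntE count_R -cntE -e vcatE dmin_rshift.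
exists (vcat a b) => [|k]; first exact: mem_dsum.
case: (letterP k) => -[i ->]; rewrite vcatE cntE.
  by rewrite dmin_lshift ea cntE count_L.
by rewrite dmin_rshift eb cntE count_R.
Qed.

Lemma L_inl t : L (inl t) = t.
Proof. by elim: t => //= i t ->; rewrite to_E. Qed.
Lemma L_inr u : L (inr u) = [::].
Proof. by elim: u => //= i u ->; rewrite to_E. Qed.
Lemma R_inl t : R (inl t) = [::].
Proof. by elim: t => //= i t ->; rewrite to_E. Qed.
Lemma R_inr u : R (inr u) = u.
Proof. by elim: u => //= i u ->; rewrite to_E. Qed.
Definition LR_E := (pmap_cat, L_inl, L_inr, R_inl, R_inr, cats0, cat0s).

Lemma inv_parity_inl t : inv_parity (inl t) = false.
Proof. by elim: t => //= i t ->; rewrite to_E. Qed.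
Lemma inv_parity_inr u : inv_parity (inr u) = false.
Proof. by elim: u => //= i u ->; rewrite L_inr andbF. Qed.

Lemma basis_inr_inl u t : basis J (inr u ++ inl t) <-> basis J1 t /\ basis J2 u.
Proof. by rewrite basis_dsum !LR_E. Qed.

Lemma basis_inl_inr t u : basis J (inl t ++ inr u) <-> basis J1 t /\ basis J2 u.
Proof. by rewrite basis_dsum !LR_E. Qed.

Lemma perm_inr_inl w : perm_eq (inr (R w) ++ inl (L w)) w.
Proof.
elim: w => //= k w IH; case: (letterP k) => -[i ->]; rewrite !to_E /=.
  by rewrite -[lshift n2 i :: inl _]cat1s perm_catCA /= perm_cons.
by rewrite perm_cons.
Qed.

(** * Vanishing of the 2 x 2 minors *)

Section Cross.
Variables (F : tract) (f : seq 'I_(n1 + n2) -> F).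
Hypothesis sf : strong_fun (rbar (r1 + r2) J) (basis J) (omega J) f.

Let h u t := f (inr u ++ inl t).
(** The minor with rows [u], [u'] and columns [t], [t'] vanishes, written without subtraction. *)
Definition cross u u' t t' :=
  tmul (h u t) (h u' t') = tmul (h u t') (h u' t).

Let h_nz u t : basis J1 t -> basis J2 u -> h u t <> tzero.
Proof.
by case: sf => supp _ _ B1 B2; apply/supp/basis_inr_inl.
Qed.

Let h_alt_l u : alt_fun (h u).
Proof.
case: sf => _ af _; have := @alt_comp _ _ _ _ (@lshift n1 n2) (inr u) [::] af.
by move=> aft a x y b; have := aft a x y b; rewrite !cats0.
Qed.

Let h_alt_r t : alt_fun (h^~ t).
Proof. by case: sf => _ af _; apply: (alt_comp (@rshift n1 n2) [::] (inl t) af). Qed.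

(* The three-term Pluecker relation with [i = x, x', y] and [j = y'], whose
   third term vanishes. *)
Lemma cross_step al x x' be y y' :
  basis J1 (rcons al x) -> basis J1 (rcons al x') ->
  basis J2 (rcons be y) -> basis J2 (rcons be y') ->
  cross (rcons be y) (rcons be y') (rcons al x) (rcons al x').
Proof.
move=> Bx Bx' By By'.
have [-> // | xx'] := eqVneq x x'.
have [-> | yy'] := eqVneq y y'; first by rewrite /cross tmulC.
have [supp af pf] := sf.
pose v := inr be ++ inl al.
(* The sign depends on [al] alone, so it cancels in each product of two values. *)
have fxy z z' : f (v ++ [:: lshift n2 z; rshift n1 z']) =
    tmul (sg F (~~ odd (size al))) (h (rcons be z') (rcons al z)).
  have := alt_catCA (inr be) (inr [:: z']) (inl (rcons al z)) [::] af.
  rewrite !cats0 /h !map_rcons -!cats1 /= -!catA /= => ->.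
  by rewrite !size_cat size_map /= mul1n addn1 /=.
have: tnull (pterms f v [:: rshift n1 y'] [::]
    [:: lshift n2 x; lshift n2 x'; rshift n1 y]).
  apply: pf => //.
    have := basis_size dsum_in_simplex
      (_ : basis J (inr (rcons be y) ++ inl (rcons al x))).
    rewrite basis_inr_inl => <- //.
    by rewrite /v !size_cat !size_map !size_rcons /=; lia.
  (* Since [x] and [x'] differ, a left letter occurs in [al], [x], [x'] together no more often than
     in one of the two bases; likewise on the right. *)
  move=> k; case: (letterP k) => -[i ->].
    rewrite -count_L !LR_E /= !to_E /= omega_lshift.
    have := basis_leq_omega i Bx; have := basis_leq_omega i Bx'.
    rewrite -!cats1 !count_cat /= !addn0.
    case: (x =P i) xx' => [-> ne _ | _ _ le_om _]; last exact: le_om.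
    have ne' : (x' == i) = false by rewrite eq_sym (negPf ne).
    by rewrite ne'.
  rewrite -count_R !LR_E /= !to_E /= omega_rshift.
  have := basis_leq_omega i By; have := basis_leq_omega i By'.
  rewrite -!cats1 !count_cat /= !addn0.
  case: (y =P i) yy' => [-> ne _ | _ _ le_om _]; last exact: le_om.
  have ne' : (y' == i) = false by rewrite eq_sym (negPf ne).
  by rewrite ne'.
rewrite /= !fxy tmul1.
(* This word has right part [be], one letter short of a basis of [J2]. *)
have -> : f (v ++ [:: lshift n2 x; lshift n2 x']) = tzero.
  apply: (strong_fun_eq0 sf) => /basis_dsum[_].
  rewrite !LR_E /= !to_E /= cats0 => /(basis_size sJ2); rewrite -(basis_size sJ2 By).
  by rewrite size_rcons; lia.
rewrite tmul0 tmulx0 => np.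
have := tnull_perm (Permutation_sym (Permutation_middle [:: _; _] [::] _)) np.
move/tnull_zero/tnull_opp_inj; rewrite !sg_mul2.
by move/esym.
Qed.

(** Columns are connected by exchange moves for all rows at once; for a single column move, rows are
    connected in turn, down to [cross_step]. Minors chain through nonzero entries by
    [tmul_cross]. *)
Lemma cross_basis u u' t t' :
  basis J2 u -> basis J2 u' -> basis J1 t -> basis J1 t' -> cross u u' t t'.
Proof.
move=> Bu Bu' Bt Bt'; move: u u' Bu Bu'.
apply: (basis_connected (Pr := fun t t' => forall u u', basis J2 u ->
  basis J2 u' -> cross u u' t t') MJ1) Bt Bt' => {t t'}.
- move=> t t' _ /perm_sign[e he] u u' _ _; rewrite /cross.
  by rewrite !(he _ _ (h_alt_l _)) tmulCA tmulA.
- move=> al x x' Bx Bx' u u'.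
  apply: (basis_connected (Pr := fun u u' => cross u u' _ _) MJ2) => {u u'}.
  + move=> u u' _ /perm_sign[e he]; rewrite /cross.
    by rewrite !(he _ _ (h_alt_r _)) !(tmulCA _ (sg F e)) (tmulC (h u _)).
  + by move=> be y y' By By'; apply: cross_step.
  move=> u v w Bu Bv Bw; rewrite /cross => c1 c2.
  by apply: tmul_cross c1 c2; apply: h_nz.
move=> t1 t2 t3 B1 B2 B3 c1 c2 u u' Bu Bu'.
move: (c1 u u' Bu Bu') (c2 u u' Bu Bu'); rewrite /cross => {}c1 {}c2.
rewrite [RHS]tmulC in c1; rewrite [RHS]tmulC in c2; rewrite [RHS]tmulC.
by apply: tmul_cross c1 c2; apply: h_nz.
Qed.

End Cross.
End DirectSum.

(** * From words to tuples *)

Lemma nth_swap (T : Type) (x0 : T) a x b y c k :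
  nth x0 (a ++ y :: b ++ x :: c) k =
  nth x0 (a ++ x :: b ++ y :: c)
    (if k == size a then size a + (size b).+1
     else if k == size a + (size b).+1 then size a else k).
Proof.
have [-> | ka] := eqVneq k (size a).
  by rewrite !nth_cat ltnn subnn ltnNge leq_addr addKn /= nth_cat ltnn subnn.
have [-> | kb] := eqVneq k (size a + (size b).+1).
  by rewrite !nth_cat ltnn subnn ltnNge leq_addr addKn /= nth_cat ltnn subnn.
rewrite !nth_cat; case: ltnP => // le_ak.
have -> : k - size a = (k - (size a).+1).+1 by lia.
rewrite /= !nth_cat; case: ltnP => // le_bk.
by have -> : k - (size a).+1 - size b = (k - (size a).+1 - (size b).+1).+1 by lia.
Qed.

Lemma split_two (T : Type) (w : seq T) i j : i < j < size w ->
  exists a x b y c,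
    [/\ w = a ++ x :: b ++ y :: c, i = size a & j = size a + (size b).+1].
Proof.
case: w => [|x0 w]; first by rewrite ltn0 andbF.
move: (x0 :: w) => v /andP[ij jv]; have iv := ltn_trans ij jv.
exists (take i v), (nth x0 v i), (take (j - i.+1) (drop i.+1 v)), (nth x0 v j),
  (drop j.+1 v).
split.
- have ej : drop j v = drop (j - i.+1) (drop i.+1 v) by rewrite drop_drop subnK.
  rewrite -(drop_nth _ jv) ej cat_take_drop.
  by rewrite -(drop_nth _ iv) cat_take_drop.
- by rewrite size_takel // ltnW.
rewrite !size_takel ?size_drop; lia.
Qed.

Section Tuples.
Variables (F : tract) (n m : nat).
Implicit Types (rho : word_fun F n m) (f : seq 'I_n -> F).

Lemma tev_tuple rho (t : m.-tuple 'I_n) : tev rho t = rho t.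
Proof. by rewrite /tev valK. Qed.

Lemma tev_out rho w : size w <> m -> tev rho w = tzero.
Proof. by move=> sw; rewrite /tev insubF //; apply/eqP. Qed.

Lemma tev_fun f w : size w = m -> tev (fun t : m.-tuple 'I_n => f t) w = f w.
Proof.
move=> /eqP sw; exact: (tev_tuple (fun t : m.-tuple 'I_n => f t) (Tuple sw)).
Qed.

Definition perm_tuple (s : 'S_m) (t : m.-tuple 'I_n) : m.-tuple 'I_n :=
  [tuple tnth t (s i) | i < m].

Lemma perm_tuple_tperm (i j : 'I_m) (t : m.-tuple 'I_n) a x b y c :
  t = a ++ x :: b ++ y :: c :> seq _ ->
  nat_of_ord i = size a -> nat_of_ord j = size a + (size b).+1 ->
  perm_tuple (tperm i j) t = a ++ y :: b ++ x :: c :> seq _.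
Proof.
move=> et ei ej.
have sz : size (a ++ y :: b ++ x :: c) == m.
  by rewrite -(size_tuple t) et !size_cat /= !size_cat.
rewrite -[RHS]/(val (Tuple sz)); congr val; apply: eq_from_tnth => k.
rewrite tnth_mktuple !(tnth_nth x) [tval (Tuple sz)]/= nth_swap et -ej -ei.
congr nth.
case: tpermP => [->|->|/eqP ki /eqP kj]; rewrite ?eqxx //.
  by rewrite ei ej; case: eqP => //; lia.
by rewrite -!val_eqE /= in ki kj; rewrite (negPf ki) (negPf kj).
Qed.

Lemma alternating_alt_fun rho : alternating rho -> alt_fun (tev rho).
Proof.
move=> alt a x y b.
have [sz | sz] := eqVneq (size (a ++ x :: y :: b)) m; last first.
  rewrite !tev_out ?tmulx0 //; apply/eqP; move: sz; rewrite !size_cat /=; lia.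
have sz' : size (a ++ x :: y :: b) == m by apply/eqP.
have ltm : size a + 1 < m by rewrite -sz size_cat /=; lia.
have ltm0 : size a < m by lia.
pose i := Ordinal ltm0; pose j := Ordinal ltm.
have := alt (tperm i j) (Tuple sz').
rewrite -[X in X = _]tev_tuple -[rho (Tuple _)]tev_tuple.
rewrite (@perm_tuple_tperm i j (Tuple sz') a x [::] y b) // odd_tperm.
by rewrite -val_eqE /= ifT //; lia.
Qed.

(** A permutation is a product of transpositions, each of which swaps two letters at a distance. *)
Lemma alt_fun_alternating f : alt_fun f ->
  alternating (fun t : m.-tuple 'I_n => f t).
Proof.
move=> af; suff H s t : f (perm_tuple s t) = tmul (sg F (odd_perm s)) (f t) by [].
have [ts -> {s}] := prod_tpermP s.
elim: ts t => [|[i j] ts IH] t.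
  rewrite big_nil odd_perm1 tmul1 => _.
  rewrite [perm_tuple _ t](_ : _ = t) //.
  by apply: eq_from_tnth => k; rewrite tnth_mktuple perm1.
rewrite [all _ _]/= => /andP[dij /IH{}IH]; rewrite big_cons.
rewrite [tperm _ _]/(tperm i j); move: IH; set s := (\prod_(_ <- _) _)%g => IH.
rewrite odd_mul_tperm -sgD.
have -> : perm_tuple (tperm i j * s) t = perm_tuple (tperm i j) (perm_tuple s t).
  by apply: eq_from_tnth => k; rewrite !tnth_mktuple permM.
rewrite -tmulA -IH; rewrite /dpair /= in dij; rewrite dij.
wlog lt_ij : i j dij / i < j.
  move=> H; case: (ltngtP i j) => [||e]; first exact: H.
    by rewrite tpermC; apply: H; rewrite eq_sym.
  by rewrite (ord_inj e) eqxx in dij.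
have [|a [x [b [y [c [et ei ej]]]]]] := @split_two _ (perm_tuple s t) i j.
  by rewrite lt_ij size_tuple ltn_ord.
by rewrite (perm_tuple_tperm et) // et alt_swap_far.
Qed.

End Tuples.

(** * Strong representations as functions on words *)

Lemma eq_pterms (T : Type) (F : tract) (f g : seq T -> F) al j pre i :
  f =1 g -> pterms f al j pre i = pterms g al j pre i.
Proof. by move=> fg; elim: i pre => //= x i IH pre; rewrite !fg IH. Qed.

Lemma eq_strong_fun (F : tract) n m B om (f g : seq 'I_n -> F) :
  f =1 g -> strong_fun m B om f -> strong_fun m B om g.
Proof.
move=> fg [supp af pf]; split=> [w | a x y b | al i j si sal cnts].
- by rewrite -fg.
- by rewrite -!fg af.
by rewrite -(eq_pterms _ _ _ _ fg); apply: pf.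
Qed.

Lemma pterms_iota (T : Type) (F : tract) (f : seq T -> F) x0 al j pre i :
  pterms f al j pre i =
  [seq tmul (sg F (odd (size pre + k)))
     (tmul (f (al ++ pre ++ take k i ++ drop k.+1 i)) (f (al ++ nth x0 i k :: j)))
   | k <- iota 0 (size i)].
Proof.
elim: i pre => //= x i IH pre; rewrite addn0 drop0 IH; congr (_ :: _).
rewrite -[1]/(1 + 0) iotaDl -map_comp; apply: eq_map => k /=.
by rewrite size_rcons addSnnS cat_rcons.
Qed.

Lemma rem_atE n s (i : s.+1.-tuple 'I_n) (k : 'I_s.+1) :
  rem_at i k = take k i ++ drop k.+1 i.
Proof.
have x0 := tnth i ord0.
have -> : rem_at i k = [seq nth x0 i l | l <- iota 0 s.+1 & l != k :> nat].
  rewrite -val_enum_ord filter_map -map_comp.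
  by apply: eq_map => l; rewrite /= (tnth_nth x0).
have ks := ltn_ord k.
have -> : iota 0 s.+1 = iota 0 k ++ nat_of_ord k :: iota k.+1 (s - k).
  have -> : iota 0 s.+1 = iota 0 (k + (s - k).+1) by congr iota; lia.
  by rewrite iotaD.
rewrite filter_cat /= eqxx /= -filter_cat.
have /all_filterP-> : all (fun l => l != k :> nat) (iota 0 k ++ iota k.+1 (s - k)).
  by apply/allP=> l; rewrite mem_cat !mem_iota; lia.
rewrite map_cat !map_nth_iota ?size_tuple //=; last by rewrite subn0 ltnW.
by rewrite drop0 [take (s - k) _]take_oversize // size_drop size_tuple.
Qed.

Lemma plucker_pterms (F : tract) n (f : seq 'I_n -> F) s (i : s.+1.-tuple 'I_n)
    al j :
  [seq tmul (tsign F (nat_of_ord k))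
        (tmul (f (al ++ rem_at i k)) (f (al ++ tnth i k :: j)))
   | k : 'I_s.+1 <- enum 'I_s.+1] = pterms f al j [::] i.
Proof.
rewrite (pterms_iota _ (tnth i ord0)) size_tuple -val_enum_ord -map_comp.
apply: eq_map => k /=.
by rewrite tsignE rem_atE -tnth_nth.
Qed.

Lemma plucker_tev (F : tract) n m om (rho : word_fun F n m) :
  plucker om rho <-> plucker_fun m om (tev rho).
Proof.
split=> [pl al i j si sal cnts | pl s /andP[s2 sm] al i j sal cnts].
  (* An empty [j] means s = 1: the two terms are opposite by commutativity. *)
  case: j si sal cnts => [|y j] si sal cnts.
    case: i si {cnts} => [|x1 [|x2 []]] //= _.
    rewrite tmul1 (tmulC (tev rho (al ++ [:: x1]))); exact: tnull_opp.
  have iP : size i == (size (y :: j)).+2 by apply/eqP.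
  have jP : size (y :: j) == (size (y :: j)).+1.-1 by [].
  have := pl (size (y :: j)).+1 _ al (Tuple iP) (Tuple jP).
  by rewrite plucker_pterms; apply; rewrite //= -?sal /=; lia.
rewrite plucker_pterms; apply: pl => //; rewrite !size_tuple; lia.
Qed.

Lemma strong_rep_tev (F : tract) n r (J : {fset vec n}) (rho : rep_type F r J) :
  in_simplex r J ->
  strong_rep rho <-> strong_fun (rbar r J) (basis J) (omega J) (tev rho).
Proof.
move=> sJ; split=> [[supp alt pl] | [supp alt pl]].
  split; [|exact: alternating_alt_fun|exact/plucker_tev].
  move=> w; have [sw | sw] := eqVneq (size w) (rbar r J).
    have sw' : size w == rbar r J by apply/eqP.
    by rewrite (tev_tuple rho (Tuple sw')); apply: supp.
  split=> [[] | /(basis_size sJ)/eqP]; last by rewrite (negPf sw).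
  by apply: tev_out; apply/eqP.
split; [|move=> s t|exact/plucker_tev].
  by move=> t; rewrite -(tev_tuple rho); apply: supp.
by rewrite -!(tev_tuple rho); apply: (alt_fun_alternating (m := rbar r J) alt).
Qed.

Lemma tev_strong_fun (F : tract) n r (J : {fset vec n}) om (f : seq 'I_n -> F) w :
  in_simplex r J -> strong_fun (rbar r J) (basis J) om f ->
  tev (fun t : (rbar r J).-tuple 'I_n => f t) w = f w.
Proof.
move=> sJ sf; have [sw | /eqP sw] := eqVneq (size w) (rbar r J).
  exact: tev_fun.
by rewrite tev_out // (strong_fun_eq0 sf) // => /(basis_size sJ).
Qed.

Lemma strong_rep_fun (F : tract) n r (J : {fset vec n}) (f : seq 'I_n -> F) :
  in_simplex r J -> strong_fun (rbar r J) (basis J) (omega J) f ->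
  strong_rep (r := r) (J := J) (fun t => f t).
Proof.
move=> sJ sf; apply/strong_rep_tev => //; apply: eq_strong_fun (sf) => w.
by rewrite (tev_strong_fun w sJ sf).
Qed.

Lemma tev_scale (F : tract) n m (rho rho' : word_fun F n m) c w :
  (forall t, rho' t = tmul c (rho t)) -> tev rho' w = tmul c (tev rho w).
Proof. by rewrite /tev; case: insub => // ?; rewrite tmulx0. Qed.

Lemma tev_rep_map (F G : tract) (f : tract_morph F G) n m (rho : word_fun F n m) w :
  tev (rep_map f rho) w = f (tev rho w).
Proof. by rewrite /tev; case: insub => //; rewrite tmap0. Qed.

Lemma rep_equiv_sym (F : tract) n m (rho rho' : word_fun F n m) :
  rep_equiv rho rho' -> rep_equiv rho' rho.
Proof.
case=> c c_nz e; have [d cd] := tinv c_nz.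
exists d => [d0 | t]; first by apply: (@tone_neq0 F); rewrite -cd d0 tmulx0.
by rewrite e tmulA (tmulC d) cd tmul1.
Qed.

Lemma rep_equiv_refl (F : tract) n m (rho rho' : word_fun F n m) :
  rho =1 rho' -> rep_equiv rho rho'.
Proof.
by move=> e; exists tone => [|t]; [apply: tone_neq0 | rewrite tmul1 e].
Qed.

(* Gr_J(F) is encoded as the set of strong F-representations modulo the
   scaling relation rep_equiv; a bijection of quotient sets is encoded by a
   map of representatives that is compatible with the relations and induces
   an injective and surjective map on classes. *)
Theorem theoremG (n1 n2 r1 r2 : nat) (J1 : {fset vec n1}) (J2 : {fset vec n2}) :
  Mconvex r1 J1 -> Mconvex r2 J2 ->
  exists Phi : forall F : tract,
      rep_type F (r1 + r2) (dsum J1 J2) -> rep_type F r1 J1 * rep_type F r2 J2,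
    [/\ (* well defined: strong representations go to pairs of strong ones *)
        forall F rho, strong_rep rho ->
          strong_rep (Phi F rho).1 /\ strong_rep (Phi F rho).2,
        (* compatible with scaling *)
        forall F rho rho', strong_rep rho -> strong_rep rho' -> rep_equiv rho rho' ->
          rep_equiv (Phi F rho).1 (Phi F rho').1 /\ rep_equiv (Phi F rho).2 (Phi F rho').2,
        (* injective on classes *)
        forall F rho rho', strong_rep rho -> strong_rep rho' ->
          rep_equiv (Phi F rho).1 (Phi F rho').1 -> rep_equiv (Phi F rho).2 (Phi F rho').2 ->
          rep_equiv rho rho',
        (* surjective on classes *)
        forall F rho1 rho2, strong_rep rho1 -> strong_rep rho2 ->
          exists2 rho, strong_rep rho &
            rep_equiv (Phi F rho).1 rho1 /\ rep_equiv (Phi F rho).2 rho2 &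
        (* natural in F *)
        forall F G (f : tract_morph F G) rho, strong_rep rho ->
          rep_equiv (Phi G (rep_map f rho)).1 (rep_map f (Phi F rho).1) /\
          rep_equiv (Phi G (rep_map f rho)).2 (rep_map f (Phi F rho).2)].
Proof.
move=> MJ1 MJ2; have [J1_neq0 sJ1 _] := MJ1; have [J2_neq0 sJ2 _] := MJ2.
have sJ := dsum_in_simplex MJ1 MJ2.
have [c Bc] := basis_exists J1_neq0; have [d Bd] := basis_exists J2_neq0.
have sc := basis_size sJ1 Bc; have sd := basis_size sJ2 Bd.
pose inl := map (@lshift n1 n2); pose inr := map (@rshift n1 n2).
(* The bases [c] and [d] are the same for every tract, so naturality holds pointwise. *)
exists (fun F rho => (fun t : (rbar r1 J1).-tuple _ => tev rho (inr d ++ inl t),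
                      fun u : (rbar r2 J2).-tuple _ => tev rho (inl c ++ inr u))).
have LR := @LR_E n1 n2.
split=> /=.
- move=> F rho /(strong_rep_tev _ sJ) sf; split.
    apply: (strong_rep_fun (f := fun t => tev rho (inr d ++ inl t))) => //.
    apply: strong_restrict sf => [|w|w le_om k].
    + by rewrite (rbar_dsum MJ1 MJ2) size_map sd addnC.
    + by rewrite (basis_inr_inl MJ1 MJ2); split=> [[]|].
    case: (letterP k) => -[i ->]; [rewrite -count_L | rewrite -count_R]; rewrite !LR /=.
      by rewrite (omega_lshift MJ1 MJ2).
    by rewrite (omega_rshift MJ1 MJ2) basis_leq_omega.
  apply: (strong_rep_fun (f := fun u => tev rho (inl c ++ inr u))) => //.
  apply: strong_restrict sf => [|w|w le_om k].
  + by rewrite (rbar_dsum MJ1 MJ2) size_map sc.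
  + by rewrite (basis_inl_inr MJ1 MJ2); split=> [[]|].
  case: (letterP k) => -[i ->]; [rewrite -count_L | rewrite -count_R]; rewrite !LR /=.
    by rewrite (omega_lshift MJ1 MJ2) basis_leq_omega.
  by rewrite (omega_rshift MJ1 MJ2).
- move=> F rho rho' _ _ [a a_nz e].
  by split; exists a => // t; apply: tev_scale.
- move=> F rho rho' /(strong_rep_tev _ sJ) sf /(strong_rep_tev _ sJ) sf'.
  case=> a a_nz ea [b b_nz eb].
  have [supp af _] := sf; have [supp' af' _] := sf'.
  have nz : tev rho (inr d ++ inl c) <> tzero.
    by apply/supp/(basis_inr_inl MJ1 MJ2).
  have nz' : tev rho' (inr d ++ inl c) <> tzero.
    by apply/supp'/(basis_inr_inl MJ1 MJ2).
  have [q q_inv] := tinv nz'.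
  have q_nz : q <> tzero.
    by move=> q0; apply: (@tone_neq0 F); rewrite -q_inv q0 tmulx0.
  (* Writing [d c] for [inr d ++ inl c], and so on, vanishing minors give
     [rho(d c) rho(u t) = rho(d t) rho(u c)], and the same for [rho']. The restrictions differ by
     [a] and [b], so [rho'(u t) = a b rho(d c) rho'(d c)^-1 rho(u t)]. *)
  exists (tmul (tmul a b) (tmul (tev rho (inr d ++ inl c)) q)).
    by apply: (tmul_neq0 (tmul_neq0 a_nz b_nz) (tmul_neq0 nz q_nz)).
  move=> w; rewrite -!tev_tuple.
  have [[B1 B2] | nB] := classic (basis J1 (pmap (@to_left n1 n2) w) /\
                                  basis J2 (pmap (@to_right n1 n2) w)); last first.
    have {}nB : ~ basis (dsum J1 J2) w by rewrite (basis_dsum MJ1 MJ2).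
    by rewrite (strong_fun_eq0 sf' nB) (strong_fun_eq0 sf nB) tmulx0.
  move: B1 B2; set t := pmap _ _; set u := pmap _ _ => B1 B2.
  (* [e] sorts [w], and [e'] exchanges the blocks [c] and [u]; both signs are common to [rho] and
     [rho']. *)
  have [e ew] := perm_sign (perm_inr_inl w).
  have [e' ecu] := perm_sign (permEl (perm_catC (inl c) (inr u))).
  have := cross_basis MJ1 MJ2 sf Bd B2 B1 Bc.
  have := cross_basis MJ1 MJ2 sf' Bd B2 B1 Bc.
  rewrite /cross !(ecu _ _ af) !(ecu _ _ af') !(ew _ _ af) !(ew _ _ af') -/t -/u.
  have /eqP size1 := basis_size sJ1 B1; have /eqP size2 := basis_size sJ2 B2.
  have := ea (Tuple size1); have := eb (Tuple size2); rewrite /= -/inl -/inr => -> ->.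
  move=> cr' cr; apply: (tmul_cancel nz').
  rewrite tmulCA -cr' [tmul (sg F e') (tmul b _)]tmulCA (tmulACA a) cr.
  rewrite [RHS]tmulA [in RHS](tmulCA _ (tmul a b)) [in RHS](tmulCA _ _ q) q_inv.
  by rewrite tmulx1 [RHS]tmulCA -(tmulA (tmul a b)).
- move=> F rho1 rho2 s1 s2.
  move/(strong_rep_tev _ sJ1): (s1) => sf1; move/(strong_rep_tev _ sJ2): (s2) => sf2.
  have sgl := glue_strong (fun t => basis_size (w := t) sJ1)
    (fun u => basis_size (w := u) sJ2) sf1 sf2
    (basis_dsum MJ1 MJ2) (omega_lshift MJ1 MJ2) (omega_rshift MJ1 MJ2).
  rewrite -(rbar_dsum MJ1 MJ2) in sgl.
  exists (fun w => glue (tev rho1) (tev rho2) w); first exact: (strong_rep_fun sJ sgl).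
  split; apply: rep_equiv_sym.
    (* In [inr d ++ inl t] every letter of [d] precedes every letter of [t], whence the sign;
       [tev rho2 d] is the constant right factor, nonzero as [d] is a basis. *)
    exists (tmul (sg F (odd (size d) && odd (rbar r1 J1))) (tev rho2 d)) => [|t].
      by apply/sg_mul_nz; case: sf2 => supp _ _; apply/supp.
    rewrite (tev_strong_fun _ sJ sgl) /glue !LR inv_parity_cat inv_parity_inl.
    by rewrite inv_parity_inr /= !LR size_tuple -tmulA (tmulC (tev rho1 _)) tev_tuple.
  (* [inl c ++ inr u] is already sorted, so the sign is trivial. *)
  exists (tmul (sg F false) (tev rho1 c)) => [|u].
    by apply/sg_mul_nz; case: sf1 => supp _ _; apply/supp.
  rewrite (tev_strong_fun _ sJ sgl) /glue !LR inv_parity_cat inv_parity_inl.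
  by rewrite inv_parity_inr /= !LR /= -tmulA tev_tuple.
move=> F G f rho _; split; apply: rep_equiv_refl => t; exact: tev_rep_map.
Qed.
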